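(* Let $X_1,X_2,\dots$ be dependent (i.e. not assumed independent) real random variables with common cumulative distribution function $F$, and let $N$ be a random variable with values in $\{0,1,2,\dots\}$ and probability mass function $p_n=\Pr(N=n)$, $n=0,1,\dots$, which is independent of the sequence $(X_i)_{i\ge 1}$. Let $S_N=X_1+\dots+X_N$ (with $S_N=0$ if $N=0$). Then the cumulative distribution function of $S_N$ is $$F_{S_N}(x)=\sum_{n=0}^\infty p_n F_X^{(n)}(x),$$ where $F_X^{(n)}$ denotes the cumulative distribution function of the sum $X_1+\dots+X_n$ of the $n$ dependent claims $(X_1,\dots,X_n)$.
   Context: The empty sum is $0$, so $F_X^{(0)}$ is the cumulative distribution function of the constant $0$. ''$N$ is independent of all $X_i$'s'' means that $N$ is independent of the whole sequence $(X_i)_{i\ge1}$ jointly. *)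

(* Defs.v *)
From HB Require Import structures.
From mathcomp Require Import all_boot all_order all_algebra.
From mathcomp Require Import all_classical all_reals all_analysis.

Set Implicit Arguments.
Unset Strict Implicit.
Unset Printing Implicit Defensive.

Import Order.TTheory GRing.Theory Num.Theory.

Local Open Scope classical_set_scope.
Local Open Scope ring_scope.

(* The library has no notion of independence. *)
Definition independent_systems d (T : measurableType d) (R : realType)
    (P : probability T R) (G H : set (set T)) : Prop :=
  forall A B, G A -> H B -> P (A `&` B) = (P A * P B)%E.

(* The sigma-algebra generated by the whole family, so that independence from
   it is joint independence and not merely independence from each Y i. *)
Definition sigma_family d d' (T : measurableType d) (T' : measurableType d')
    (I : Type) (Y : I -> T -> T') : set (set T) :=
  <<s \bigcup_i g_sigma_algebra_preimage (Y i) >>.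

Definition independent_of_family d d1 d2 (T : measurableType d)
    (T1 : measurableType d1) (T2 : measurableType d2) (R : realType)
    (P : probability T R) (I : Type)
    (N : {RV P >-> T1}) (Y : I -> {RV P >-> T2}) : Prop :=
  independent_systems P (g_sigma_algebra_preimage N)
    (sigma_family (fun i => Y i : T -> T2)).

Section sums.
Context d (T : measurableType d) (R : realType) (P : probability T R).
Variable X : nat -> {RV P >-> R}.

(* The sequence is indexed from 0: the informal X_i is X i.-1. *)
Definition partial_sum_fun (n : nat) : T -> R :=
  fun w => \sum_(i < n) X i w.

Lemma measurable_partial_sum n : measurable_fun setT (partial_sum_fun n).
Proof. by apply: measurable_sum => i; exact: measurable_funPT. Qed.

HB.instance Definition _ n := isMeasurableFun.Build _ _ _ _
  (partial_sum_fun n) (measurable_partial_sum n).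

Definition partial_sum (n : nat) : {RV P >-> R} := partial_sum_fun n.

Variable N : {RV P >-> nat}.

Definition random_sum_fun : T -> R := fun w => \sum_(i < N w) X i w.

Lemma measurable_random_sum : measurable_fun setT random_sum_fun.
Proof.
move=> _ B mB; rewrite setTI.
have -> : random_sum_fun @^-1` B =
    \bigcup_n (N @^-1` [set n] `&` partial_sum_fun n @^-1` B).
  apply/seteqP; split => [w Bw|w [n _ [/= <-]] //].
  by exists (N w).
apply: bigcup_measurable => n _; apply: measurableI.
  by rewrite -[X in measurable X]setTI; exact: measurable_funPT.
by rewrite -[X in measurable X]setTI; exact: measurable_partial_sum.
Qed.

HB.instance Definition _ := isMeasurableFun.Build _ _ _ _
  random_sum_fun measurable_random_sum.

Definition random_sum : {RV P >-> R} := random_sum_fun.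

End sums.

(* Main.v *)
Require Import Defs.
From mathcomp Require Import all_boot all_order all_algebra.
From mathcomp Require Import all_classical all_reals all_analysis.

Local Open Scope classical_set_scope.
Local Open Scope ereal_scope.

(** Where [N] equals n, the random sum is the n-th partial sum, so the values of [N] split the event
    that the random sum is at most x into countably many disjoint pieces. Countable additivity gives
    a series, and independence factors each term, because by [sigma_family_partial_sum] an event
    about a partial sum belongs to the sigma-algebra of the whole sequence. *)

Lemma sigma_family_partial_sum (d : measure_display) (T : measurableType d)
    (R : realType) (P : probability T R) (X : nat -> {RV P >-> R}) (n : nat)
    (B : set R) : measurable B ->
  sigma_family (fun i => X i : T -> R) (partial_sum X n @^-1` B).
Proof.
move=> mB.
(* Over T equipped with the sigma-algebra generated by G, every X i is
   measurable, hence so is the partial sum. *)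
pose G := \bigcup_i g_sigma_algebra_preimage (X i : T -> R).
have mX i : measurable_fun setT (X i : g_sigma_algebraType G -> R).
  move=> _ A mA; rewrite setTI; apply: sub_sigma_algebra.
  by exists i => //; exists A => //; rewrite setTI.
have mS : measurable_fun setT
    (partial_sum X n : g_sigma_algebraType G -> R).
  exact: measurable_sum.
(* Being measurable in [g_sigma_algebraType G] is, by definition, membership in [sigma_family]. *)
by have := mS measurableT B mB; rewrite setTI.
Qed.

Theorem theorem2 (d : measure_display) (T : measurableType d) (R : realType)
    (P : probability T R)
    (X : nat -> {RV P >-> R}) (F : R -> R)
    (X_cdf : forall (i : nat) (x : R), cdf (X i) x = (F x)%:E)
    (N : {RV P >-> nat}) (p : nat -> R)
    (N_pmf : forall n : nat, P (N @^-1` [set n]) = (p n)%:E)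
    (N_indep : independent_of_family N X) :
  forall x : R,
    cdf (random_sum X N) x =
      \sum_(0 <= n <oo) (p n)%:E * cdf (partial_sum X n) x.
Proof.
move=> x.
pose A n := N @^-1` [set n] `&` partial_sum X n @^-1` `]-oo, x].
have mA n : measurable (A n).
  apply: measurableI; rewrite -[X in measurable X]setTI.
  - exact: measurable_funPT.
  - by apply: measurable_funPT => //; exact: measurable_itv.
have -> : cdf (random_sum X N) x = P (\bigcup_n A n).
  congr (P _); apply/seteqP; split => [w Sw|w [n _ [/= <-]] //].
  by exists (N w).
rewrite measure_semi_bigcup //.
- apply: eq_eseriesr => n _.
  (* Joint independence matters here: the partial sum involves several [X i] at once. *)
  rewrite -N_pmf; apply: N_indep; last exact: sigma_family_partial_sum.
  by exists [set n] => //; rewrite setTI.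
(* At a common point w of [A i] and [A j], both indices equal [N w]. *)
- by move=> i j _ _ [w [[/= <- _] [/= <- _]]].
- exact: bigcup_measurable.
Qed.
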